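(* Let $\mathcal{C}$ be a $k$-CSP for some $k\in\mathbb{Z}^+$, and suppose that for some $p\in[1,\infty)$ and $\varepsilon>0$ there exists a computable $(p,k,C,\varepsilon)$-isolating lattice for every $C\in\mathcal{C}$. Then for every $0<s\le c\le1$ there exists a polynomial-time (Karp) reduction from $(s,c)$-Gap-$\mathcal{C}$ instances on $n$ variables to $\gamma$-$\mathrm{CVP}_p$ instances of rank $n$, with $\gamma=\gamma(p,\varepsilon,s,c)$ satisfying \[ \gamma^p=\frac{1-s(1-1/(1+\varepsilon)^p)}{1-c(1-1/(1+\varepsilon)^p)}. \]
   Context: A $k$-constraint is a function $C:\{0,1\}^k\to\{0,1\}$; a $k$-CSP is a finite set $\mathcal{C}$ of $k$-constraints. An instance $\Phi$ on variables $x_1,\dots,x_n$ consists of $m$ constraints from $\mathcal{C}$, each applied to $k$ (not necessarily distinct) variables; $\mathrm{val}(\Phi)$ is the maximum fraction of constraints satisfied by an assignment in $\{0,1\}^n$. $(s,c)$-Gap-$\mathcal{C}$: distinguish $\mathrm{val}(\Phi)\ge c$ (YES) from $\mathrm{val}(\Phi)<s$ (NO). For $\varepsilon\ge0$, $V\in\mathbb{R}^{d^*\times k}$ with full column rank and $\vec t^*\in\mathbb{R}^{d^*}$ define a $(p,k,C,\varepsilon)$-isolating lattice if $\|V\vec x-\vec t^*\|_p=1$ for $\vec x\in C^{-1}(1)$, $\|V\vec x-\vec t^*\|_p=1+\varepsilon$ for $\vec x\in C^{-1}(0)$, and $\|V\vec x-\vec t^*\|_p\ge1+\varepsilon$ for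 $\vec x\in\mathbb{Z}^k\setminus\{0,1\}^k$; here $\|\vec x\|_p=(\sum_i|x_i|^p)^{1/p}$. $\gamma$-$\mathrm{CVP}_p$: given a basis $B\in\mathbb{R}^{d\times n}$ (linearly independent columns), $\vec t$ and $r>0$, distinguish $\min_{\vec z\in\mathbb{Z}^n}\|B\vec z-\vec t\|_p\le r$ (YES) from $>\gamma r$ (NO). A Karp reduction maps YES to YES and NO to NO. *)

(* Defs.v *)
From HB Require Import structures.
From mathcomp Require Import all_boot all_order all_algebra.
From mathcomp Require Import all_classical all_reals all_analysis.

Set Implicit Arguments.
Unset Strict Implicit.
Unset Printing Implicit Defensive.

Import Order.TTheory GRing.Theory Num.Theory.
Local Open Scope ring_scope.

(* Model of computation: first-order recursive programs over binary trees.    *)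
(* All functions are unary; [Case e e1 e2] evaluates e1 when e is a leaf and  *)
(* otherwise e2 with the two subtrees pushed on the environment.  A program   *)
(* is the list of its function bodies, and function 0 is the entry point.     *)

Inductive tree := Leaf | Node of tree & tree.

Fixpoint tsize (t : tree) : nat :=
  if t is Node l r then (tsize l + tsize r).+1 else 1%N.

Inductive expr :=
  | Var of nat
  | Lf
  | Nd of expr & expr
  | Case of expr & expr & expr
  | Call of nat & expr.

Definition program := seq expr.

(* [eval P rho e v t]: e evaluates to v in environment rho in time t.  Every  *)
(* step is charged the size of the tree it returns, so that t bounds the cost *)
(* of an implementation without sharing, and is polynomially related to       *)
(* Turing machine time.                                                       *)
Inductive eval (P : program) : seq tree -> expr -> tree -> nat -> Prop :=
  | EvalVar rho i :
      eval P rho (Var i) (nth Leaf rho i) (tsize (nth Leaf rho i))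
  | EvalLf rho : eval P rho Lf Leaf 1
  | EvalNd rho e1 e2 v1 v2 t1 t2 :
      eval P rho e1 v1 t1 -> eval P rho e2 v2 t2 ->
      eval P rho (Nd e1 e2) (Node v1 v2) (t1 + t2 + tsize (Node v1 v2))%N
  | EvalCaseLeaf rho e e1 e2 v t t1 :
      eval P rho e Leaf t -> eval P rho e1 v t1 ->
      eval P rho (Case e e1 e2) v (t + t1 + tsize v)%N
  | EvalCaseNode rho e e1 e2 l r v t t2 :
      eval P rho e (Node l r) t -> eval P [:: l, r & rho] e2 v t2 ->
      eval P rho (Case e e1 e2) v (t + t2 + tsize v)%N
  | EvalCall rho f e u v t t' :
      eval P rho e u t -> eval P [:: u] (nth Lf P f) v t' ->
      eval P rho (Call f e) v (t + t' + tsize v)%N.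

Definition runs (P : program) (x v : tree) (t : nat) : Prop :=
  eval P [:: x] (nth Lf P 0) v t.

Definition enc_nat (n : nat) : tree := iter n (Node Leaf) Leaf.
Definition enc_seq (s : seq tree) : tree := foldr Node Leaf s.

(* A promise problem: [repr w x] says that the tree w is an encoding of the   *)
(* instance x.                                                                *)
Record promise_problem := PromiseProblem {
  instance : Type;
  repr : tree -> instance -> Prop;
  yes : instance -> Prop;
  no : instance -> Prop }.

(* Polynomial-time many-one reduction mapping every instance x of A to an     *)
(* instance y of B such that [rel x y].                                       *)
Definition karp_reduction (A B : promise_problem)
    (rel : instance A -> instance B -> Prop) : Prop :=
  exists (P : program) (a b : nat), forall (w : tree) (x : instance A),
    repr w x ->
    exists (v : tree) (t : nat) (y : instance B),
      [/\ runs P w v t, (t <= a * tsize w ^ b)%N & repr v y] /\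
      [/\ rel x y, yes x -> yes y & no x -> no y].

Definition computable_real (R : realType) (x : R) : Prop :=
  exists P : program, forall q : nat, exists (u v t : nat),
    runs P (enc_nat q) (Node (enc_nat u) (enc_nat v)) t /\
    `|x - (u%:R - v%:R) / 2 ^+ q| <= 2 ^- q.

Definition kconstraint (k : nat) := {ffun k.-tuple bool -> bool}.

Definition applied_constraint (k n : nat) : Type :=
  kconstraint k * k.-tuple 'I_n.

Record csp_instance (k : nat) (CC : {set kconstraint k}) := CSPInstance {
  nvars : nat;
  constraints : seq (applied_constraint k nvars);
  constraints_neq0 : (0 < size constraints)%N;
  constraints_in :
    all (fun Cx : applied_constraint k nvars => Cx.1 \in CC) constraints }.

Section CSP.
Context (R : realType) (k : nat) (CC : {set kconstraint k}).
Implicit Type Phi : csp_instance CC.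

Definition nsat Phi (a : {ffun 'I_(nvars Phi) -> bool}) : nat :=
  count (fun Cx : applied_constraint k (nvars Phi) => Cx.1 (map_tuple a Cx.2))
        (constraints Phi).

Definition csp_val Phi : R :=
  \big[Num.max/0]_(a : {ffun 'I_(nvars Phi) -> bool})
    ((nsat a)%:R / (size (constraints Phi))%:R).

(* Unary numerals: the number of variables counts towards the input size.  A  *)
(* constraint is named by its position in the fixed list [enum CC].           *)
Definition enc_csp Phi : tree :=
  Node (enc_nat (nvars Phi))
    (enc_seq [seq Node (enc_nat (index Cx.1 (enum CC)))
                       (enc_seq [seq enc_nat (nat_of_ord j) | j <- Cx.2])
             | Cx : applied_constraint k (nvars Phi) <- constraints Phi]).

Definition gap_csp (s c : R) : promise_problem :=
  @PromiseProblem (csp_instance CC)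
    (fun w Phi => w = enc_csp Phi)
    (fun Phi => c <= csp_val Phi)
    (fun Phi => csp_val Phi < s).

End CSP.

Definition lpnorm (R : realType) (p : R) (d : nat) (x : 'cV[R]_d) : R :=
  (\sum_i `|x i 0| `^ p) `^ p^-1.

Definition intcol (R : realType) (n : nat) (z : 'cV[int]_n) : 'cV[R]_n :=
  map_mx intr z.

Definition bitcol (k : nat) (x : k.-tuple bool) : 'cV[int]_k :=
  \col_i (tnth x i : nat)%:Z.

Record shifted_lattice (R : realType) (k : nat) := ShiftedLattice {
  sl_dim : nat;
  sl_basis : 'M[R]_(sl_dim, k);
  sl_target : 'cV[R]_sl_dim }.

Definition sl_dist (R : realType) (k : nat) (p : R)
    (L : shifted_lattice R k) (x : 'cV[int]_k) : R :=
  lpnorm p (sl_basis L *m intcol R x - sl_target L).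

Definition isolating_lattice (R : realType) (k : nat) (p : R)
    (C : kconstraint k) (eps : R) (L : shifted_lattice R k) : Prop :=
  [/\ \rank (sl_basis L) = k,
      forall x : k.-tuple bool, C x -> sl_dist p L (bitcol x) = 1,
      forall x : k.-tuple bool, ~~ C x -> sl_dist p L (bitcol x) = 1 + eps &
      forall x : 'cV[int]_k, (forall b : k.-tuple bool, x <> bitcol b) ->
        1 + eps <= sl_dist p L x].

Definition is_entry (R : realType) (k : nat) (L : shifted_lattice R k)
    (x : R) : Prop :=
  (exists i j, x = sl_basis L i j) \/ (exists i, x = sl_target L i 0).

Definition computable_lattice (R : realType) (k : nat)
    (L : shifted_lattice R k) : Prop :=
  forall x : R, is_entry L x -> computable_real x.

(* Exact finite names for the real numbers occurring in CVP instances:        *)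
(* division-free arithmetic expressions over a finite list K of constants.    *)
(* Such formulas have no powers, so a name of length l denotes a number of    *)
(* magnitude at most exponential in l.                                        *)
Inductive rexpr :=
  | RConst of nat
  | RZero
  | ROne
  | RAdd of rexpr & rexpr
  | ROpp of rexpr
  | RMul of rexpr & rexpr.

Fixpoint rval (R : realType) (K : seq R) (e : rexpr) : R :=
  match e with
  | RConst i => nth 0 K i
  | RZero => 0
  | ROne => 1
  | RAdd e1 e2 => rval K e1 + rval K e2
  | ROpp e1 => - rval K e1
  | RMul e1 e2 => rval K e1 * rval K e2
  end.

Fixpoint enc_rexpr (e : rexpr) : tree :=
  match e with
  | RConst i => Node (enc_nat 0) (enc_nat i)
  | RZero => Node (enc_nat 1) Leaf
  | ROne => Node (enc_nat 2) Leaf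
  | RAdd e1 e2 => Node (enc_nat 3) (Node (enc_rexpr e1) (enc_rexpr e2))
  | ROpp e1 => Node (enc_nat 4) (enc_rexpr e1)
  | RMul e1 e2 => Node (enc_nat 5) (Node (enc_rexpr e1) (enc_rexpr e2))
  end.

Record cvp_instance (R : realType) := CVPInstance {
  cvp_dim : nat;
  cvp_rank : nat;
  cvp_basis : 'M[R]_(cvp_dim, cvp_rank);
  cvp_target : 'cV[R]_cvp_dim;
  cvp_radius : R;
  cvp_basis_rank : \rank cvp_basis = cvp_rank;
  cvp_radius_gt0 : 0 < cvp_radius }.

(* The infimum is a minimum, the columns of the basis being independent.      *)
Definition cvp_dist (R : realType) (p : R) (I : cvp_instance R) : R :=
  inf [set x : R | exists z : 'cV[int]_(cvp_rank I),
         x = lpnorm p (cvp_basis I *m intcol R z - cvp_target I)]%classic.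

(* The radius r is written down through an expression for r ^ p.              *)
Definition cvp_repr (R : realType) (p : R) (K : seq R) (w : tree)
    (I : cvp_instance R) : Prop :=
  exists (eB : 'I_(cvp_dim I) -> 'I_(cvp_rank I) -> rexpr)
         (et : 'I_(cvp_dim I) -> rexpr) (er : rexpr),
    [/\ w = enc_seq
         [:: enc_nat (cvp_dim I); enc_nat (cvp_rank I);
             enc_seq [seq enc_seq [seq enc_rexpr (eB i j)
                                  | j <- enum 'I_(cvp_rank I)]
                     | i <- enum 'I_(cvp_dim I)];
             enc_seq [seq enc_rexpr (et i) | i <- enum 'I_(cvp_dim I)];
             enc_rexpr er],
        forall i j, cvp_basis I i j = rval K (eB i j),
        forall i, cvp_target I i 0 = rval K (et i) &
        cvp_radius I = rval K er `^ p^-1].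

Definition gap_cvp (R : realType) (p gamma : R) (K : seq R) :
    promise_problem :=
  @PromiseProblem (cvp_instance R)
    (cvp_repr p K)
    (fun I => cvp_dist p I <= cvp_radius I)
    (fun I => gamma * cvp_radius I < cvp_dist p I).

(* The real numbers that the reduction may treat as exact constants.          *)
Definition reduction_constant (R : realType) (k : nat)
    (CC : {set kconstraint k}) (L : kconstraint k -> shifted_lattice R k)
    (p eps s c x : R) : Prop :=
  x \in [:: p; eps; s; c; (1 + eps) `^ p] \/
  exists2 C, C \in CC & is_entry (L C) x.

(* Main.v *)
(**
  A constraint C applied to the variables x contributes the rows of V_C P_x,
  with target t_C, where P_x selects the coordinates x.  Write
  E = (1 + eps)^p.  For an integer vector z the p-th power of the distance is
  the sum over the constraints of |V_C (P_x z) - t_C|^p.  A summand is 1 if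
  P_x z is a satisfying 0/1 assignment of C and at least E otherwise, so the
  minimum over z is m E - sat (E - 1), where sat is the largest number of
  satisfied constraints: values of z outside {0, 1} can be replaced by 0
  without increasing the bound.  Hence val >= c puts the target within
  r^p = m (c + (1 - c) E), and val < s puts it beyond m (s + (1 - s) E).

  The reduction is computed by a function in a class of polynomial-time tree
  functions closed under composition, pairing, case analysis and recursion
  along a list whose steps increase the size additively.
*)

From Pilot Require Import Defs.
From HB Require Import structures.
From mathcomp Require Import all_boot all_order all_algebra.
From mathcomp Require Import all_classical all_reals all_analysis.
From mathcomp Require Import zify ring lra.

Set Implicit Arguments.
Unset Strict Implicit.
Unset Printing Implicit Defensive.

Import Order.TTheory GRing.Theory Num.Theory.
Local Open Scope ring_scope.

(* [tsize] and [eval] are shadowed by the libraries loaded after [Defs].      *)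
Import Pilot.Defs.

(** * Polynomial-time functions on trees *)

Section Machine.
Local Open Scope nat_scope.

Definition pbound (f : tree -> nat) : Prop :=
  exists a b, forall x, f x <= a * tsize x ^ b.

Lemma tsize_gt0 x : 0 < tsize x.
Proof. by case: x. Qed.

Lemma leq_exp2rW m n e : m <= n -> m ^ e <= n ^ e.
Proof. by case: e => // e mn; rewrite leq_exp2r. Qed.

Lemma pbound_le f g : (forall x, f x <= g x) -> pbound g -> pbound f.
Proof.
by move=> fg [a [b gb]]; exists a, b => x; apply: leq_trans (fg x) (gb x).
Qed.

Lemma pbound_const n : pbound (fun=> n).
Proof. by exists n, 0 => x; rewrite expn0 muln1. Qed.

Lemma pbound_tsize : pbound tsize.
Proof. by exists 1, 1 => x; rewrite expn1 mul1n. Qed.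

Lemma pbound_add f g : pbound f -> pbound g -> pbound (fun x => f x + g x).
Proof.
move=> [a [b fb]] [a' [b' gb]]; exists (a + a'), (maxn b b') => x.
rewrite mulnDl leq_add //.
  by rewrite (leq_trans (fb x))// leq_mul// leq_pexp2l ?tsize_gt0// leq_maxl.
by rewrite (leq_trans (gb x))// leq_mul// leq_pexp2l ?tsize_gt0// leq_maxr.
Qed.

Lemma pbound_mul f g : pbound f -> pbound g -> pbound (fun x => f x * g x).
Proof.
move=> [a [b fb]] [a' [b' gb]]; exists (a * a'), (b + b') => x.
by rewrite expnD mulnACA leq_mul.
Qed.

Lemma pbound_exp f n : pbound f -> pbound (fun x => f x ^ n).
Proof.
move=> [a [b fb]]; exists (a ^ n), (b * n) => x.
by rewrite expnM -expnMn leq_exp2rW.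
Qed.

Lemma pbound_comp f g :
  pbound f -> pbound (tsize \o g) -> pbound (f \o g).
Proof.
move=> [a [b fb]] gb.
apply: (@pbound_le _ (fun x => a * tsize (g x) ^ b)) => [x|]; first exact: fb.
by apply: pbound_mul; [exact: pbound_const|exact: pbound_exp].
Qed.

(* The code [Ps] is to be placed at an arbitrary offset [n] and followed by   *)
(* arbitrary code, so that linking two programs is appending them.            *)
Definition polytime (F : tree -> tree) : Prop :=
  forall n, exists (Ps : program) (e : expr) (T : tree -> nat), pbound T /\
    forall Q Q', size Q = n -> forall x,
      exists2 t, eval (Q ++ Ps ++ Q') [:: x] e (F x) t & t <= T x.

(** Every rule charges at least the size of the tree it returns, so a time bound also controls the
    sizes of values. *)
Lemma eval_tsize P rho e v t : eval P rho e v t -> tsize v <= t.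
Proof. by case=> *; rewrite ?leq_addl. Qed.

Lemma polytime_tsize F : polytime F -> pbound (tsize \o F).
Proof.
move=> /(_ 0) [Ps [e [T [Tb +]]]] => /(_ [::] [::] erefl) H.
apply: pbound_le Tb => x; have [t ev tT] := H x.
exact: leq_trans (eval_tsize ev) tT.
Qed.

Lemma polytime_id : polytime (fun x => x).
Proof.
move=> n; exists [::], (Var 0), tsize; split; first exact: pbound_tsize.
by move=> Q Q' _ x; exists (tsize x) => //; apply: EvalVar.
Qed.

Fixpoint cexpr (t : tree) : expr :=
  if t is Node l r then Nd (cexpr l) (cexpr r) else Lf.

Lemma eval_cexpr v : exists t, forall P rho, eval P rho (cexpr v) v t.
Proof.
elim: v => [|l [tl Hl] r [tr Hr]]; first by exists 1 => *; apply: EvalLf.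
by exists (tl + tr + tsize (Node l r)) => P rho; apply: EvalNd.
Qed.

Lemma polytime_const v : polytime (fun=> v).
Proof.
move=> n; have [t Ht] := eval_cexpr v.
exists [::], (cexpr v), (fun=> t); split; first exact: pbound_const.
by move=> Q Q' _ x; exists t.
Qed.

Lemma polytime_node F G :
  polytime F -> polytime G -> polytime (fun x => Node (F x) (G x)).
Proof.
move=> hF hG n; have [PF [eF [TF [TFb HF]]]] := hF n.
have [PG [eG [TG [TGb HG]]]] := hG (n + size PF).
exists (PF ++ PG), (Nd eF eG), (fun x => TF x + TG x + (TF x + TG x + 1)).
split.
  by do ![apply: pbound_add => //]; apply: pbound_const.
move=> Q Q' sQ x; have [tF evF leF] := HF Q (PG ++ Q') sQ x.
have [|tG evG leG] := HG (Q ++ PF) Q' _ x; first by rewrite size_cat sQ.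
rewrite -!catA in evF evG *; eexists; first exact: EvalNd evF evG.
by have /= := eval_tsize evF; have /= := eval_tsize evG; lia.
Qed.

Definition tfst t := if t is Node l _ then l else Leaf.
Definition tsnd t := if t is Node _ r then r else Leaf.

Lemma nth_cat_size (P Q : program) e n :
  n = size P -> nth Lf (P ++ e :: Q) n = e.
Proof. by move=> ->; rewrite nth_cat ltnn subnn. Qed.

Lemma polytime_comp F G :
  polytime F -> polytime G -> polytime (fun x => F (G x)).
Proof.
move=> hF hG n; have [PG [eG [TG [TGb HG]]]] := hG n.
have [PF [eF [TF [TFb HF]]]] := hF (n + size PG).
(* [eF] expects its argument as the only variable, so it becomes a function body of its own, called
   on the value of [eG]. *)
exists (PG ++ PF ++ [:: eF]), (Call (n + size PG + size PF) eG).
exists (fun x => TG x + TF (G x) + TF (G x)); split.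
  have := pbound_comp TFb (polytime_tsize hG).
  by move=> ?; do ![apply: pbound_add => //].
move=> Q Q' sQ x; have [tG evG leG] := HG Q (PF ++ [:: eF] ++ Q') sQ x.
have [|tF evF leF] := HF (Q ++ PG) ([:: eF] ++ Q') _ (G x).
  by rewrite size_cat sQ.
have Pf : nth Lf (Q ++ PG ++ PF ++ [:: eF] ++ Q') (n + size PG + size PF) = eF.
  by rewrite !catA -catA nth_cat_size// !size_cat sQ.
rewrite -!catA in evF evG *.
eexists; first by apply: EvalCall evG _; rewrite Pf; exact: evF.
by have := eval_tsize evF; lia.
Qed.

Lemma polytime_tfst F : polytime F -> polytime (fun x => tfst (F x)).
Proof.
apply: (@polytime_comp tfst) => n.
exists [::], (Case (Var 0) Lf (Var 0)), (fun x => tsize x + tsize x + tsize x + 2).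
split.
  do ![apply: pbound_add => //]; by [apply: pbound_const|apply: pbound_tsize].
move=> Q Q' _ [|l r].
  eexists; first by apply: EvalCaseLeaf; [exact: EvalVar|exact: EvalLf].
  by [].
eexists; first by apply: EvalCaseNode; [exact: EvalVar|exact: EvalVar].
by rewrite /=; lia.
Qed.

Lemma polytime_tsnd F : polytime F -> polytime (fun x => tsnd (F x)).
Proof.
apply: (@polytime_comp tsnd) => n.
exists [::], (Case (Var 0) Lf (Var 1)), (fun x => tsize x + tsize x + tsize x + 2).
split.
  do ![apply: pbound_add => //]; by [apply: pbound_const|apply: pbound_tsize].
move=> Q Q' _ [|l r].
  eexists; first by apply: EvalCaseLeaf; [exact: EvalVar|exact: EvalLf].
  by [].
eexists; first by apply: EvalCaseNode; [exact: EvalVar|exact: EvalVar].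
by rewrite /=; lia.
Qed.

Lemma polytime_if F G H : polytime F -> polytime G -> polytime H ->
  polytime (fun x => if F x is Leaf then G x else H x).
Proof.
move=> hF hG hH n; have [PF [eF [TF [TFb HF]]]] := hF n.
have [PG [eG [TG [TGb HG]]]] := hG (n + size PF).
have [PH [eH [TH [THb HH]]]] := hH (n + size PF + size PG).
exists (PF ++ PG ++ PH ++ [:: eH]).
(* The node branch runs with two subtrees pushed, so the input is [Var 2] there; the call restores
   the one-variable environment that [eH] expects. *)
exists (Case eF eG (Call (n + size PF + size PG + size PH) (Var 2))).
exists (fun x => TF x + (TG x + TG x) + (TH x + TH x + TH x) + tsize x); split.
  by do ![apply: pbound_add => //]; apply: pbound_tsize.
move=> Q Q' sQ x.
have [tF evF leF] := HF Q (PG ++ PH ++ [:: eH] ++ Q') sQ x.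
have [|tG evG leG] := HG (Q ++ PF) (PH ++ [:: eH] ++ Q') _ x.
  by rewrite size_cat sQ.
have [|tH evH leH] := HH (Q ++ PF ++ PG) ([:: eH] ++ Q') _ x.
  by rewrite !size_cat sQ addnA.
have Pf : nth Lf (Q ++ PF ++ PG ++ PH ++ [:: eH] ++ Q')
                 (n + size PF + size PG + size PH) = eH.
  by rewrite !catA -catA nth_cat_size// !size_cat sQ.
rewrite -!catA in evF evG evH *; case: (F x) evF => [|l r] evF.
  eexists; first exact: EvalCaseLeaf evF evG.
  by have := eval_tsize evG; lia.
eexists.
  apply: EvalCaseNode evF _; apply: EvalCall; first exact: EvalVar.
  by rewrite Pf; exact: evH.
by have := eval_tsize evH; rewrite /=; lia.
Qed.

(** * Recursion along a list *)

Section Recursion.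
Variables base step : tree -> tree.

(** A paramorphism along the right spine: the step receives the parameter, the current list
    including its head, and the recursive value. *)
Fixpoint para (c l : tree) : tree :=
  if l is Node _ l' then step (Node c (Node l (para c l'))) else base c.

Let paraF x := if x is Node c l then para c l else Leaf.

(** The bound on the output size also covers the intermediate values, which are outputs on suffixes
    of the list. Hence every round calls [base] or [step] on an argument of polynomial size. *)
Lemma polytime_paraF : polytime base -> polytime step ->
  pbound (tsize \o paraF) -> polytime paraF.
Proof.
move=> hB hS [za [zb Zb]] n; have [PB [eB [TB [[ba [bb TBb]] HB]]]] := hB n.
have [PS [eS [TS [[sa [sb TSb]] HS]]]] := hS (n + size PB).
pose f0 := n + size PB + size PS.
(* In the innermost branch the environment is head, tail, c, l, input. The functions [f0], [f0.+1]
   and [f0.+2] are the base, the step and this loop itself. *)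
pose body :=
  Case (Var 0) Lf
    (Case (Var 1) (Call f0 (Var 0))
      (Call f0.+1 (Nd (Var 2) (Nd (Var 3) (Call f0.+2 (Nd (Var 2) (Var 1))))))).
pose Z x := za * tsize x ^ zb.
(* [D] bounds one round: copying, a call to [base] and a call to [step]. The [+ 2] covers the two
   nodes that pair up the argument of [step]. *)
pose D x := 20 * (tsize x + Z x) + ba * tsize x ^ bb +
            sa * (tsize x + Z x + 2) ^ sb.
exists (PB ++ PS ++ [:: eB; eS; body]), body, (fun x => tsize x * D x + 10).
split.
  rewrite /D /Z.
  do ![exact: pbound_tsize | exact: pbound_const | apply: pbound_add
      | apply: pbound_mul | apply: pbound_exp].
move=> Q Q' sQ; set P := Q ++ _.
have szP : size (Q ++ PB ++ PS) = f0 by rewrite !size_cat sQ addnA.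
have EP : P = (Q ++ PB ++ PS) ++ [:: eB, eS, body & Q'].
  by rewrite /P -!catA.
have P0 : nth Lf P f0 = eB by rewrite EP nth_cat_size.
have P1 : nth Lf P f0.+1 = eS.
  by rewrite EP -cat_rcons nth_cat_size// size_rcons szP.
have P2 : nth Lf P f0.+2 = body.
  by rewrite EP -2!cat_rcons nth_cat_size// !size_rcons szP.
have evB x : exists2 t, eval P [:: x] eB (base x) t & t <= TB x.
  by have := HB Q (PS ++ [:: eB, eS, body & Q']) sQ x; rewrite /P -!catA.
have evS x : exists2 t, eval P [:: x] eS (step x) t & t <= TS x.
  have := HS (Q ++ PB) ([:: eB, eS, body & Q']) _ x.
  by rewrite /P -!catA; apply; rewrite size_cat sQ.
case=> [|c l].
  eexists; first by apply: EvalCaseLeaf; [exact: EvalVar|exact: EvalLf].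
  by rewrite /=; lia.
set X := Node c l; have sX : tsize X = (tsize c + tsize l).+1 by [].
(* The bound per round stays fixed at the whole input [X] while the list shrinks. *)
suff H l1 : tsize l1 <= tsize l ->
    exists2 t, eval P [:: Node c l1] body (para c l1) t & t <= tsize l1 * D X.
  have [//|t ev le] := H l; exists t => //; apply: (leq_trans le).
  by rewrite (leq_trans _ (leq_addr _ _))// leq_mul2r /=
     (leq_trans _ (leqnSn _)) ?orbT ?leq_addl.
have leZ l2 : tsize l2 <= tsize l -> tsize (para c l2) <= Z X.
  move=> ll; apply: leq_trans (Zb (Node c l2)) _.
  by rewrite leq_mul2l leq_exp2rW ?orbT //= ltnS leq_add2l.
elim: l1 => [_|h _ l' IH ll].
  have [t ev le] := evB c.
  eexists.
    apply: EvalCaseNode; first exact: EvalVar.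
    apply: EvalCaseLeaf; first exact: EvalVar.
    by apply: EvalCall; [exact: EvalVar|rewrite P0; exact: ev].
  have := eval_tsize ev; have := TBb c.
  have : ba * tsize c ^ bb <= ba * tsize X ^ bb.
    by rewrite leq_mul2l leq_exp2rW ?orbT //= ltnW// ltnS leq_addr.
  by move: (leZ Leaf (tsize_gt0 _)); rewrite /D /=; lia.
have ll' : tsize l' <= tsize l by apply: leq_trans ll; rewrite /=; lia.
have [t ev le] := IH ll'; set l1 := Node h l'; set acc := para c l'.
have [t1 ev1 le1] := evS (Node c (Node l1 acc)).
eexists.
  apply: EvalCaseNode; first exact: EvalVar.
  apply: EvalCaseNode; first exact: EvalVar.
  apply: EvalCall; last by rewrite P1; exact: ev1.
  apply: EvalNd; first exact: EvalVar.
  apply: EvalNd; first exact: EvalVar.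
  apply: EvalCall; last by rewrite P2; exact: ev.
  by apply: EvalNd; exact: EvalVar.
have vt := eval_tsize ev1.
have accZ := leZ _ ll'; rewrite -/acc in accZ.
have : TS (Node c (Node l1 acc)) <= sa * (tsize X + Z X + 2) ^ sb.
  apply: leq_trans (TSb _) _; rewrite leq_mul2l leq_exp2rW ?orbT //.
  by move: ll accZ; rewrite sX /=; lia.
have := leZ _ ll.
have : tsize l' * D X + D X <= tsize l1 * D X.
  by rewrite -mulSnr leq_mul// ltnS leq_addl.
have : D X = 20 * (tsize X + Z X) + ba * tsize X ^ bb +
             sa * (tsize X + Z X + 2) ^ sb by [].
move: ll vt le; rewrite /=; move: (D X) (Z X) accZ => d z accZ.
move: (_ ^ sb) (_ ^ bb) => u v.
move: (tsize l' * d) (_ * d) (sa * u) (ba * v) => *; lia.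
Qed.

(** The increment [g] does not see the accumulator, which excludes the exponential growth of
    iterated polynomial steps: the output is at most the base value plus [tsize l] polynomial
    increments. *)
Lemma polytime_para g F G : polytime base -> polytime step -> pbound g ->
  (forall c l acc, tsize (step (Node c (Node l acc))) <=
                   tsize acc + g (Node c l)) ->
  polytime F -> polytime G -> polytime (fun x => para (F x) (G x)).
Proof.
move=> hB hS [ga [gb Gb]] hg hF hG.
apply: (@polytime_comp paraF (fun x => Node (F x) (G x))); last first.
  exact: polytime_node.
apply: polytime_paraF => //; have [ba [bb Bb]] := polytime_tsize hB.
apply: (@pbound_le _ (fun x => ba * tsize x ^ bb +
                               tsize x * (ga * tsize x ^ gb) + 1)); last first.
  do ![exact: pbound_tsize | exact: pbound_const | apply: pbound_add
      | apply: pbound_mul | apply: pbound_exp].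
case=> [|c l /=]; first by rewrite /=; lia.
set X := (tsize c + tsize l).+1.
suff H l1 : tsize l1 <= tsize l ->
    tsize (para c l1) <= ba * X ^ bb + tsize l1 * (ga * X ^ gb).
  apply: leq_trans (H l (leqnn _)) _.
  rewrite (leq_trans _ (leq_addr _ _))// leq_add2l leq_mul2r.
  by rewrite /X (leq_trans _ (leqnSn _)) ?orbT ?leq_addl.
elim: l1 => [_|h _ l' IH ll] /=.
  apply: leq_trans (Bb c) _; rewrite (leq_trans _ (leq_addr _ _))//.
  by rewrite leq_mul2l leq_exp2rW ?orbT //= ltnW// ltnS leq_addr.
apply: leq_trans (hg _ _ _) _.
have /IH {}IH : tsize l' <= tsize l by apply: leq_trans ll; rewrite /=; lia.
have : g (Node c (Node h l')) <= ga * X ^ gb.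
  apply: leq_trans (Gb _) _; rewrite leq_mul2l leq_exp2rW ?orbT //.
  by rewrite /X; move: ll; rewrite /=; lia.
rewrite mulSn mulnDl; lia.
Qed.

End Recursion.

End Machine.

Ltac ptime := repeat first
  [ exact: polytime_id | exact: polytime_const | assumption
  | apply: polytime_tfst | apply: polytime_tsnd | apply: polytime_node ].

(** * Functions on encoded lists and unary numerals *)

Section Combinators.
Local Open Scope nat_scope.

Lemma tsize_tfst t : tsize (tfst t) <= tsize t.
Proof. by case: t => //= l r; rewrite leqW// leq_addr. Qed.

Lemma tsize_tsnd t : tsize (tsnd t) <= tsize t.
Proof. by case: t => //= l r; rewrite leqW// leq_addl. Qed.

Definition tapp (s1 s2 : tree) : tree :=
  para id (fun y => Node (tfst (tfst (tsnd y))) (tsnd (tsnd y))) s2 s1.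

Lemma tappE s1 s2 : tapp (enc_seq s1) (enc_seq s2) = enc_seq (s1 ++ s2).
Proof. by rewrite /tapp; elim: s1 => //= h s1 ->. Qed.

Lemma tsize_tapp s1 s2 : tsize (tapp s1 s2) <= tsize s1 + tsize s2.
Proof. by rewrite /tapp; elim: s1 => //= h _ s1; lia. Qed.

Lemma polytime_tapp F G :
  polytime F -> polytime G -> polytime (fun x => tapp (F x) (G x)).
Proof.
move=> hF hG; apply: (polytime_para (g := tsize)) => //; ptime.
  exact: pbound_tsize.
by move=> c l acc /=; have := tsize_tfst l; lia.
Qed.

Definition tmap (f : tree -> tree) (c l : tree) : tree :=
  para (fun=> Leaf)
    (fun y => Node (f (Node (tfst y) (tfst (tfst (tsnd y))))) (tsnd (tsnd y)))
    c l.

Lemma tmapE f c s : tmap f c (enc_seq s) = enc_seq [seq f (Node c x) | x <- s].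
Proof. by rewrite /tmap; elim: s => //= h s ->. Qed.

Lemma polytime_tmap f F G : polytime f ->
  polytime F -> polytime G -> polytime (fun x => tmap f (F x) (G x)).
Proof.
move=> hf hF hG; pose g y := tsize (f (Node (tfst y) (tfst (tsnd y)))) + 1.
apply: (polytime_para (g := g)) => //; ptime.
- by apply: polytime_comp => //; ptime.
- apply: pbound_add; last exact: pbound_const.
  apply: (@polytime_tsize (fun y => f (Node (tfst y) (tfst (tsnd y))))).
  by apply: polytime_comp => //; ptime.
- by move=> c l acc; rewrite /g /=; lia.
Qed.

Definition tflat (f : tree -> tree) (c l : tree) : tree :=
  para (fun=> Leaf)
    (fun y => tapp (f (Node (tfst y) (tfst (tfst (tsnd y))))) (tsnd (tsnd y)))
    c l.

(** The predicate [P] confines the claim about [f] to elements such as constraints from [CC], whose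
    names the program can resolve. *)
Lemma tflatE (T : Type) (P : pred T) f c (enc : T -> tree) h (s : seq T) :
  (forall x, P x -> f (Node c (enc x)) = enc_seq (h x)) -> all P s ->
  tflat f c (enc_seq [seq enc x | x <- s]) = enc_seq (flatten [seq h x | x <- s]).
Proof.
move=> fE; rewrite /tflat; elim: s => //= x s IH /andP[Px /IH ->].
by rewrite fE// tappE.
Qed.

Lemma polytime_tflat f F G : polytime f ->
  polytime F -> polytime G -> polytime (fun x => tflat f (F x) (G x)).
Proof.
move=> hf hF hG; pose g y := tsize (f (Node (tfst y) (tfst (tsnd y)))).
apply: (polytime_para (g := g)) => //; ptime.
- by apply: polytime_tapp; ptime; apply: polytime_comp => //; ptime.
- apply: (@polytime_tsize (fun y => f (Node (tfst y) (tfst (tsnd y))))).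
  by apply: polytime_comp => //; ptime.
- by move=> c l acc; rewrite addnC; apply: tsize_tapp.
Qed.

(** With the tag of [RAdd] or [RMul] this writes the code of an iterated sum or product. *)
Definition tfold (tag : tree) (base f : tree -> tree) (c l : tree) : tree :=
  para base
    (fun y => Node tag (Node (f (Node (tfst y) (tfst (tfst (tsnd y)))))
                             (tsnd (tsnd y))))
    c l.

Lemma tfoldE tag base f c s : tfold tag base f c (enc_seq s) =
  foldr (fun x acc => Node tag (Node (f (Node c x)) acc)) (base c) s.
Proof. by rewrite /tfold; elim: s => //= h s ->. Qed.

Lemma polytime_tfold tag base f F G : polytime base -> polytime f ->
  polytime F -> polytime G -> polytime (fun x => tfold tag base f (F x) (G x)).
Proof.
move=> hb hf hF hG.
pose g y := tsize (f (Node (tfst y) (tfst (tsnd y)))) + (tsize tag + 2).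
apply: (polytime_para (g := g)) => //; ptime.
- by apply: polytime_comp => //; ptime.
- apply: pbound_add; last exact: pbound_const.
  apply: (@polytime_tsize (fun y => f (Node (tfst y) (tfst (tsnd y))))).
  by apply: polytime_comp => //; ptime.
- by move=> c l acc; rewrite /g /=; lia.
Qed.

(** A numeral is a list of leaves, so [tsnd] is the predecessor; iterating it along [n] gives
    truncated subtraction. *)
Definition tsub (m n : tree) : tree :=
  para id (fun y => tsnd (tsnd (tsnd y))) m n.

Lemma tsubE m n : tsub (enc_nat m) (enc_nat n) = enc_nat (m - n).
Proof.
rewrite /tsub; elim: n => [|n /= ->]; first by rewrite subn0.
by rewrite subnS; case: (m - n).
Qed.

Lemma polytime_tsub F G :
  polytime F -> polytime G -> polytime (fun x => tsub (F x) (G x)).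
Proof.
move=> hF hG; apply: (polytime_para (g := fun=> 0)) => //; ptime.
  exact: pbound_const.
by move=> c l acc /=; rewrite addn0 tsize_tsnd.
Qed.

Definition tifeq (m n u v : tree) : tree :=
  if tsub m n is Leaf then if tsub n m is Leaf then u else v else v.

Lemma tifeqE m n u v :
  tifeq (enc_nat m) (enc_nat n) u v = if m == n then u else v.
Proof.
rewrite /tifeq !tsubE; case: ltngtP => [mn|nm|->]; last by rewrite subnn.
  have /eqP -> : m - n == 0 by rewrite subn_eq0 ltnW.
  by move: mn; rewrite -subn_gt0; case: (n - m).
by move: nm; rewrite -subn_gt0; case: (m - n).
Qed.

Lemma polytime_tifeq F G u v : polytime F -> polytime G ->
  polytime (fun x => tifeq (F x) (G x) u v).
Proof.
by move=> hF hG; do ![apply: polytime_if]; ptime; apply: polytime_tsub.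
Qed.

(** The recursion counts down while the entries must count up: with [m] elements to go, the entry is
    [n - m]. *)
Definition tiota (n : tree) : tree :=
  para (fun=> Leaf)
    (fun y => Node (tsub (tfst y) (tfst (tsnd y))) (tsnd (tsnd y))) n n.

Lemma tiotaE n : tiota (enc_nat n) = enc_seq [seq enc_nat i | i <- iota 0 n].
Proof.
rewrite /tiota; set step := (X in para _ X).
suff H m : m <= n -> para (fun=> Leaf) step (enc_nat n) (enc_nat m) =
    enc_seq [seq enc_nat i | i <- iota (n - m) m] by rewrite H// subnn.
elim: m => // m IH mn.
rewrite -[LHS]/(Node (tsub (enc_nat n) (enc_nat m.+1))
                     (para (fun=> Leaf) step (enc_nat n) (enc_nat m))).
by rewrite IH 1?ltnW// tsubE /= -(subSn mn) subSS.
Qed.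

Lemma polytime_tiota F : polytime F -> polytime (fun x => tiota (F x)).
Proof.
move=> hF; pose g y := tsize (tsub (tfst y) (tsnd y)) + 1.
apply: (polytime_para (g := g)) => //; ptime.
- by apply: polytime_tsub; ptime.
- apply: pbound_add; last exact: pbound_const.
  apply: (@polytime_tsize (fun y => tsub (tfst y) (tsnd y))).
  by apply: polytime_tsub; ptime.
- by move=> c l acc; rewrite /g /=; lia.
Qed.

Definition tnthl (i : nat) (l : tree) : tree := tfst (iter i tsnd l).

Lemma tnthlE i s : tnthl i (enc_seq s) = nth Leaf s i.
Proof.
elim: i s => [|i IH] s; first by case: s.
rewrite /tnthl iterSr -/(tnthl i _); case: s => [|x s]; last exact: IH.
by rewrite (IH [::]) !nth_nil.
Qed.

Lemma polytime_tnthl i F : polytime F -> polytime (fun x => tnthl i (F x)).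
Proof.
by move=> hF; apply: polytime_tfst; elim: i => //= i IH; apply: polytime_tsnd.
Qed.

(** The list belongs to the program and not to its input, so the fold unrolls into a composition of
    fixed length. *)
Lemma polytime_foldr (I : Type) (s : seq I) (G : I -> tree -> tree) F :
  (forall i, polytime (G i)) -> polytime F ->
  polytime (fun x => foldr (fun i acc => G i (Node x acc)) (F x) s).
Proof.
move=> hG hF; elim: s => //= i s IH.
by apply: polytime_comp => //; apply: polytime_node => //; apply: polytime_id.
Qed.

Fixpoint tswitch (fs : seq (tree -> tree)) (i x : tree) : tree :=
  if fs is f :: fs' then
    if i is Leaf then f x else tswitch fs' (tsnd i) x
  else Leaf.

Lemma tswitchE fs i x :
  tswitch fs (enc_nat i) x = nth (fun=> Leaf) fs i x.
Proof. by elim: fs i => [|f fs IH] [|i] //=; rewrite IH. Qed.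

Lemma polytime_tswitch (I : Type) (s : seq I) (f : I -> tree -> tree) F G :
  (forall i, polytime (f i)) -> polytime F -> polytime G ->
  polytime (fun x => tswitch [seq f i | i <- s] (F x) (G x)).
Proof.
move=> hf hF hG; elim: s F hF => [|i s IH] F hF /=; ptime.
apply: polytime_if => //; first exact: polytime_comp.
by apply: IH; ptime.
Qed.

End Combinators.

(** * The program of the reduction *)

Section Program.
Local Open Scope nat_scope.
Variables (R : realType) (k : nat) (CC : {set kconstraint k}).
Variables (L : kconstraint k -> shifted_lattice R k) (K : seq R) (e0 : rexpr).
Implicit Types (Lc : shifted_lattice R k) (Phi : csp_instance CC).
Local Arguments enc_rexpr : simpl never.

(** Outside [K] the name would denote the default 0, so its correctness rests on membership in
    [K]. *)
Definition cname (x : R) : rexpr := RConst (index x K).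

Definition ifeq (i j : nat) (u v : rexpr) : rexpr := if i == j then u else v.

(** This is entry (r, j) of V_C P_x; columns add up when a constraint repeats a variable. *)
Definition lat_entry Lc (r : 'I_(sl_dim Lc)) (vs : seq nat) (j : nat) : rexpr :=
  foldr (fun (l : 'I_k) acc =>
           RAdd (RMul (cname (sl_basis Lc r l)) (ifeq (nth 0 vs l) j ROne RZero))
                acc)
        RZero (enum 'I_k).

(* A row of the stacked lattice is paired with its entry of the target.       *)
Definition lat_rows Lc (vs : seq nat) (n : nat) : seq (seq rexpr * rexpr) :=
  [seq ([seq lat_entry r vs j | j <- iota 0 n], cname (sl_target Lc r 0%R))
  | r <- enum 'I_(sl_dim Lc)].

(** An entry of the identity matrix, times a product over [vs] that annihilates row i as soon as i
    occurs in [vs]. *)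
Definition free_entry (vs : seq nat) (i j : nat) : rexpr :=
  foldr (fun v => RMul (ifeq v i RZero ROne)) (ifeq i j ROne RZero) vs.

(* A variable occurring in no constraint has a zero column in the stacked     *)
(* lattices; these rows restore full column rank.                             *)
Definition free_rows (vs : seq nat) (n : nat) : seq (seq rexpr * rexpr) :=
  [seq ([seq free_entry vs i j | j <- iota 0 n], RZero) | i <- iota 0 n].

Definition cvars n (Cx : applied_constraint k n) : seq nat :=
  [seq nat_of_ord j | j <- Cx.2].

Definition red_vars Phi : seq nat :=
  flatten [seq cvars Cx | Cx <- constraints Phi].

Definition red_rows Phi : seq (seq rexpr * rexpr) :=
  flatten [seq lat_rows (L Cx.1) (cvars Cx) (nvars Phi)
          | Cx : applied_constraint k (nvars Phi) <- constraints Phi] ++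
  free_rows (red_vars Phi) (nvars Phi).

(** Expressions have no integer literals, so the multiple m of [e0] is written as a repeated sum. *)
Definition red_radius Phi : rexpr :=
  foldr (fun _ => RAdd e0) RZero (constraints Phi).

Definition enc_row (r : seq rexpr * rexpr) : tree :=
  Node (enc_seq [seq enc_rexpr e | e <- r.1]) (enc_rexpr r.2).

Definition enc_red Phi : tree :=
  enc_seq [:: enc_nat (size (red_rows Phi)); enc_nat (nvars Phi);
    enc_seq [seq enc_seq [seq enc_rexpr e | e <- r.1] | r <- red_rows Phi];
    enc_seq [seq enc_rexpr r.2 | r <- red_rows Phi];
    enc_rexpr (red_radius Phi)].

(** The argument is laid out as ((variables, column), accumulator); 3 and 5 are the tags of [RAdd]
    and [RMul]. *)
Definition tlat_term Lc (r : 'I_(sl_dim Lc)) (l : 'I_k) (z : tree) : tree :=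
  Node (enc_nat 3) (Node
    (Node (enc_nat 5)
      (Node (enc_rexpr (cname (sl_basis Lc r l)))
        (tifeq (tnthl l (tfst (tfst z))) (tsnd (tfst z))
               (enc_rexpr ROne) (enc_rexpr RZero))))
    (tsnd z)).

Definition tlat_entry Lc (r : 'I_(sl_dim Lc)) (y : tree) : tree :=
  foldr (fun l acc => tlat_term r l (Node y acc)) (enc_rexpr RZero) (enum 'I_k).

Lemma nth_enc_nat vs i :
  nth Leaf [seq enc_nat v | v <- vs] i = enc_nat (nth 0 vs i).
Proof. by elim: vs i => [|v vs IH] [|i] /=. Qed.

Lemma enc_ifeq i j u v :
  tifeq (enc_nat i) (enc_nat j) (enc_rexpr u) (enc_rexpr v) =
  enc_rexpr (ifeq i j u v).
Proof. by rewrite tifeqE /ifeq; case: eqP. Qed.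

Lemma tlat_entryE Lc (r : 'I_(sl_dim Lc)) vs j :
  tlat_entry r (Node (enc_seq [seq enc_nat v | v <- vs]) (enc_nat j)) =
  enc_rexpr (lat_entry r vs j).
Proof.
rewrite /tlat_entry /lat_entry; elim: (enum _) => // l s /= ->.
rewrite /tlat_term /=.
by rewrite tnthlE nth_enc_nat enc_ifeq.
Qed.

Lemma polytime_tlat_entry Lc (r : 'I_(sl_dim Lc)) : polytime (tlat_entry r).
Proof.
apply: (@polytime_foldr _ _ (@tlat_term Lc r) (fun=> _)) => [l|]; ptime.
by apply: polytime_tifeq; [apply: polytime_tnthl|]; ptime.
Qed.

Definition tlat_row Lc (r : 'I_(sl_dim Lc)) (z : tree) : tree :=
  Node (Node (tmap (tlat_entry r) (tsnd (tfst z)) (tfst (tfst z)))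
             (enc_rexpr (cname (sl_target Lc r 0%R))))
       (tsnd z).

Definition tlat_rows Lc (y : tree) : tree :=
  foldr (fun r acc => tlat_row r (Node y acc)) Leaf (enum 'I_(sl_dim Lc)).

Definition enc_nats (s : seq nat) : tree := enc_seq [seq enc_nat i | i <- s].

Lemma tlat_rowsE Lc vs n :
  tlat_rows Lc (Node (enc_nats (iota 0 n)) (enc_nats vs)) =
  enc_seq [seq enc_row r | r <- lat_rows Lc vs n].
Proof.
rewrite /tlat_rows /lat_rows; elim: (enum _) => // r s /= ->.
rewrite /tlat_row tmapE /enc_row /= -!map_comp; congr (Node (Node (enc_seq _) _) _).
by apply: eq_map => j /=; rewrite tlat_entryE.
Qed.

Lemma polytime_tlat_rows Lc : polytime (tlat_rows Lc).
Proof.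
apply: (@polytime_foldr _ _ (@tlat_row Lc) (fun=> _)) => [r|]; ptime.
by apply: polytime_tmap; ptime; apply: polytime_tlat_entry.
Qed.

(** Since [CC] is finite, the program holds one row generator per constraint and selects it by the
    name in the input. *)
Definition tcon_rows (y : tree) : tree :=
  tswitch [seq tlat_rows (L C) | C <- enum CC] (tfst (tsnd y))
    (Node (tfst y) (tsnd (tsnd y))).

Lemma tcon_rowsE (C : kconstraint k) vs n : C \in CC ->
  tcon_rows (Node (enc_nats (iota 0 n))
                  (Node (enc_nat (index C (enum CC))) (enc_nats vs))) =
  enc_seq [seq enc_row r | r <- lat_rows (L C) vs n].
Proof.
move=> CCC; rewrite /tcon_rows tswitchE /= (nth_map C); last first.
  by rewrite index_mem mem_enum.
by rewrite nth_index ?mem_enum// tlat_rowsE.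
Qed.

Lemma polytime_tcon_rows : polytime tcon_rows.
Proof.
by apply: polytime_tswitch; ptime => C; apply: polytime_tlat_rows.
Qed.

Definition tfree_entry (y : tree) : tree :=
  tfold (enc_nat 5)
    (fun z => tifeq (tfst z) (tsnd z) (enc_rexpr ROne) (enc_rexpr RZero))
    (fun z => tifeq (tsnd z) (tfst (tfst z)) (enc_rexpr RZero) (enc_rexpr ROne))
    (Node (tfst (tfst y)) (tsnd y)) (tsnd (tfst y)).

Lemma tfree_entryE i vs j :
  tfree_entry (Node (Node (enc_nat i) (enc_nats vs)) (enc_nat j)) =
  enc_rexpr (free_entry vs i j).
Proof.
rewrite /tfree_entry tfoldE /free_entry /= enc_ifeq.
by elim: vs => // v vs /= ->; rewrite enc_ifeq.
Qed.

Lemma polytime_tfree_entry : polytime tfree_entry.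
Proof.
by apply: polytime_tfold; ptime; apply: polytime_tifeq; ptime.
Qed.

Definition tfree_rows (cols vs : tree) : tree :=
  tmap (fun z => Node (tmap tfree_entry (Node (tsnd z) (tsnd (tfst z)))
                            (tfst (tfst z)))
                      (enc_rexpr RZero))
    (Node cols vs) cols.

Lemma tfree_rowsE n vs :
  tfree_rows (enc_nats (iota 0 n)) (enc_nats vs) =
  enc_seq [seq enc_row r | r <- free_rows vs n].
Proof.
rewrite /tfree_rows {2}/enc_nats tmapE /free_rows -!map_comp.
congr enc_seq; apply: eq_map => i /=; rewrite tmapE /enc_row /= -!map_comp.
by congr (Node (enc_seq _) _); apply: eq_map => j /=; rewrite tfree_entryE.
Qed.

Lemma polytime_tfree_rows F G : polytime F -> polytime G ->
  polytime (fun x => tfree_rows (F x) (G x)).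
Proof.
move=> hF hG; apply: polytime_tmap; ptime.
by apply: polytime_tmap; ptime; apply: polytime_tfree_entry.
Qed.

Definition tred_rows (w : tree) : tree :=
  tapp (tflat tcon_rows (tiota (tfst w)) (tsnd w))
       (tfree_rows (tiota (tfst w))
                   (tflat (fun z => tsnd (tsnd z)) Leaf (tsnd w))).

Lemma tred_rowsE Phi :
  tred_rows (enc_csp Phi) = enc_seq [seq enc_row r | r <- red_rows Phi].
Proof.
rewrite /tred_rows /= tiotaE -/(enc_nats (iota 0 (nvars Phi))).
rewrite (tflatE (h := fun Cx : applied_constraint k (nvars Phi) =>
   [seq enc_row r | r <- lat_rows (L Cx.1) (cvars Cx) (nvars Phi)])
   _ (constraints_in Phi)); last first.
  by move=> Cx CxC; rewrite -tcon_rowsE// /enc_nats /cvars -map_comp.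
rewrite (tflatE (h := fun Cx : applied_constraint k (nvars Phi) =>
   [seq enc_nat j | j <- cvars Cx]) (P := predT)); last 2 first.
- by move=> Cx _ /=; rewrite /cvars -map_comp.
- by rewrite all_predT.
rewrite (map_comp (map enc_nat)) -map_flatten -/(enc_nats _) tfree_rowsE tappE.
rewrite /red_rows map_cat; congr (enc_seq (_ ++ _)).
by rewrite map_flatten -!map_comp.
Qed.

Lemma polytime_tred_rows : polytime tred_rows.
Proof.
have iotaP : polytime (fun w => tiota (tfst w)).
  by apply: polytime_tiota; ptime.
apply: polytime_tapp.
  by apply: polytime_tflat; ptime; apply: polytime_tcon_rows.
by apply: polytime_tfree_rows => //; apply: polytime_tflat; ptime.
Qed.

(** Replacing each row by a leaf turns the list of rows into the unary numeral of its length, the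
    dimension. *)
Definition tred (w : tree) : tree :=
  Node (tmap (fun=> Leaf) Leaf (tred_rows w)) (Node (tfst w)
    (Node (tmap (fun z => tfst (tsnd z)) Leaf (tred_rows w))
      (Node (tmap (fun z => tsnd (tsnd z)) Leaf (tred_rows w))
        (Node (tfold (enc_nat 3) (fun=> enc_rexpr RZero) (fun=> enc_rexpr e0)
                     Leaf (tsnd w))
              Leaf)))).

Lemma tredE Phi : tred (enc_csp Phi) = enc_red Phi.
Proof.
rewrite /tred tred_rowsE !tmapE -!map_comp /enc_red /=; congr (Node _ _).
  by elim: (red_rows Phi) => //= r rs ->.
do 3![congr (Node _ _)]; congr (Node _ _); rewrite tfoldE /red_radius.
by elim: (constraints Phi) => //= Cx s ->.
Qed.

Lemma polytime_tred : polytime tred.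
Proof.
have rowsP := polytime_tred_rows.
by ptime; first [apply: polytime_tmap | apply: polytime_tfold]; ptime.
Qed.

End Program.

(** * The stacked lattice *)

Section Rows.
Variables (R : realType) (K : seq R) (n : nat) (rows : seq (seq rexpr * rexpr)).

Definition row_dot (s : seq rexpr) (w : 'cV[R]_n) : R :=
  \sum_(j < n) rval K (nth RZero s j) * w j 0.

Let row_at (i : nat) := nth ([::], RZero) rows i.

Definition rows_basis : 'M[R]_(size rows, n) :=
  \matrix_(i, j) rval K (nth RZero (row_at i).1 j).

Definition rows_target : 'cV[R]_(size rows) := \col_i rval K (row_at i).2.

(** A general [h] serves both the squares used for the rank and the p-th powers used for the
    distance. *)
Lemma sum_rows (h : R -> R -> R) (w : 'cV[R]_n) :
  \sum_i h ((rows_basis *m w) i 0) (rows_target i 0) =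
  \sum_(r <- rows) h (row_dot r.1 w) (rval K r.2).
Proof.
rewrite (big_nth ([::], RZero)) big_mkord; apply: eq_bigr => i _.
by rewrite !mxE; congr h; apply: eq_bigr => j _; rewrite mxE.
Qed.

(** Triviality of the kernel is phrased by a sum of squares because such a sum splits along blocks
    of rows. *)
Lemma rank_rows_basis :
  (forall w, \sum_(r <- rows) row_dot r.1 w ^+ 2 = 0 -> w = 0) ->
  \rank rows_basis = n.
Proof.
move=> inj; apply/eqP; rewrite -mxrank_tr; apply: inj_row_free => v vB.
apply: trmx_inj; rewrite trmx0; apply: inj.
rewrite -(sum_rows (fun x _ => x ^+ 2)) big1// => i _.
have -> : rows_basis *m v^T = 0.
  by rewrite -[rows_basis]trmxK -trmx_mul vB trmx0.
by rewrite mxE expr0n.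
Qed.

Lemma lpnorm_rows (p : R) (w : 'cV[R]_n) :
  lpnorm p (rows_basis *m w - rows_target) =
  (\sum_(r <- rows) `|row_dot r.1 w - rval K r.2| `^ p) `^ p^-1.
Proof.
rewrite /lpnorm -(sum_rows (fun x y => `|x - y| `^ p)); congr (_ `^ _).
by apply: eq_bigr => i _; rewrite !mxE.
Qed.

End Rows.

Lemma map_nth_ord (T U : Type) (x0 : T) (f : T -> U) (s : seq T) n :
  size s = n -> [seq f (nth x0 s (nat_of_ord i)) | i <- enum 'I_n] = map f s.
Proof.
move=> <-; rewrite (map_comp (fun i => f (nth x0 s i)) (@nat_of_ord _)).
by rewrite val_enum_ord (map_comp f) map_nth_iota0// take_size.
Qed.

(** * Rank, distances and correctness of the constructed instance *)

Section Reduction.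
Variables (R : realType) (k : nat) (CC : {set kconstraint k}).
Variables (p eps : R) (L : kconstraint k -> shifted_lattice R k).
Variables (K : seq R) (e0 : rexpr).
Hypotheses (hp : 1 <= p) (heps : 0 < eps).
Hypothesis hL : forall C, C \in CC -> isolating_lattice p C eps (L C).
Hypothesis hK : forall C x, C \in CC -> is_entry (L C) x -> x \in K.
Implicit Type Phi : csp_instance CC.

Let p_gt0 : 0 < p. Proof. exact: lt_le_trans ltr01 hp. Qed.

Let E := (1 + eps) `^ p.

Lemma lpnorm_powR d (x : 'cV[R]_d) : lpnorm p x `^ p = \sum_i `|x i 0| `^ p.
Proof.
rewrite /lpnorm -powRrM mulVf ?gt_eqF// powRr1// sumr_ge0//.
Qed.

Lemma rval_lat_entry C (r : 'I_(sl_dim (L C))) vs j : C \in CC ->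
  rval K (lat_entry K r vs j) =
  \sum_(l < k) sl_basis (L C) r l * (nth 0%N vs l == j)%:R.
Proof.
move=> CCC; rewrite /lat_entry -[in RHS]big_enum /=; elim: (enum _) => [|l s IH].
  by rewrite big_nil.
rewrite big_cons /= IH nth_index; last by apply: hK CCC _; left; exists r, l.
by rewrite /ifeq; case: eqP.
Qed.

Lemma rval_free_entry vs i j :
  rval K (free_entry vs i j) = ((i == j) && (i \notin vs))%:R.
Proof.
rewrite /free_entry; elim: vs => [|v vs IH] /=.
  by rewrite andbT /ifeq; case: eqP.
rewrite IH inE negb_or /ifeq (eq_sym v); case: eqP => _ /=; rewrite ?mul1r//.
by rewrite mul0r andbF.
Qed.

Lemma size_red_rows Phi :
  all (fun r => size r.1 == nvars Phi) (red_rows L K Phi).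
Proof.
rewrite /red_rows all_cat; apply/andP; split.
  elim: (constraints Phi) => //= Cx s IH; rewrite all_cat IH andbT.
  by rewrite all_map; apply/allP => r _ /=; rewrite size_map size_iota.
by rewrite all_map; apply/allP => r _ /=; rewrite size_map size_iota.
Qed.

(** The selection P_x, generic in the entries since it acts on integer and on real vectors. *)
Definition sel n (T : Type) (x : k.-tuple 'I_n) (w : 'cV[T]_n) : 'cV[T]_k :=
  \col_l w (tnth x l) 0.

Lemma row_dot_lat n (Cx : applied_constraint k n) (r : 'I_(sl_dim (L Cx.1))) w :
  Cx.1 \in CC ->
  row_dot K [seq lat_entry K r (cvars Cx) j | j <- iota 0 n] w =
  (sl_basis (L Cx.1) *m sel Cx.2 w) r 0.
Proof.
move=> CxC; rewrite /row_dot mxE.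
under eq_bigr => j _.
  rewrite (nth_map 0%N) ?size_iota// nth_iota// add0n rval_lat_entry// mulr_suml.
  over.
rewrite exchange_big; apply: eq_bigr => l _ /=; rewrite mxE.
rewrite (bigD1 (tnth Cx.2 l))//= big1 ?addr0 => [|j jl].
  rewrite (nth_map (tnth Cx.2 l)) ?size_tuple//.
  by rewrite -tnth_nth eqxx mulr1.
rewrite (nth_map (tnth Cx.2 l)) ?size_tuple// -tnth_nth.
by rewrite (inj_eq val_inj) eq_sym (negPf jl) mulr0 mul0r.
Qed.

Definition free_var Phi (i : 'I_(nvars Phi)) : bool :=
  (i : nat) \notin red_vars Phi.

Lemma free_varN Phi (Cx : applied_constraint k (nvars Phi)) l :
  Cx \in constraints Phi -> free_var (tnth Cx.2 l) = false.
Proof.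
move=> CxP; apply: negbF; apply/flattenP; exists (cvars Cx).
  exact: map_f.
by apply: map_f; exact: mem_tnth.
Qed.

(** The rows of a constraint see only P_x w, and the free rows form a diagonal 0/1 matrix with
    target 0. *)
Lemma sum_red_rows Phi (h : R -> R -> R) (w : 'cV[R]_(nvars Phi)) :
  \sum_(r <- red_rows L K Phi) h (row_dot K r.1 w) (rval K r.2) =
  \sum_(Cx <- constraints Phi) \sum_i
     h ((sl_basis (L Cx.1) *m sel Cx.2 w) i 0) (sl_target (L Cx.1) i 0) +
  \sum_i h ((free_var i)%:R * w i 0) 0.
Proof.
rewrite /red_rows big_cat big_flatten /= big_map; congr (_ + _).
  apply: eq_big_seq => Cx CxP.
  have CxC := allP (constraints_in Phi) _ CxP.
  rewrite big_map big_enum /=; apply: eq_bigr => r _.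
  by rewrite row_dot_lat// nth_index//; apply: hK CxC _; right; exists r.
rewrite big_map [LHS](big_nth 0%N) size_iota big_mkord; apply: eq_bigr => i _.
rewrite nth_iota// add0n; congr h.
rewrite /row_dot (bigD1 i)//= big1 ?addr0 => [|j ji].
  by rewrite (nth_map 0%N) ?size_iota// nth_iota// rval_free_entry eqxx.
rewrite (nth_map 0%N) ?size_iota// nth_iota// rval_free_entry add0n.
by rewrite (inj_eq val_inj) eq_sym (negPf ji) mul0r.
Qed.

(** Let all rows vanish on w. A free coordinate is zero by its own row; any other is an entry of
    some P_x w, which is zero because V_C has full column rank. *)
Lemma rank_red_basis Phi :
  \rank (rows_basis K (nvars Phi) (red_rows L K Phi)) = nvars Phi.
Proof.
apply: rank_rows_basis => w; rewrite (sum_red_rows (fun x _ => x ^+ 2)).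
move/eqP; rewrite paddr_eq0; last 2 first.
- by rewrite sumr_ge0// => Cx _; rewrite sumr_ge0// => i _; exact: sqr_ge0.
- by rewrite sumr_ge0// => i _; exact: sqr_ge0.
case/andP=> lat0 free0; apply/colP => i; rewrite [in RHS]mxE.
have [fi|] := boolP (free_var i).
  move: free0; rewrite psumr_eq0 => [/allP/(_ i)|j _]; last exact: sqr_ge0.
  by rewrite mem_index_enum fi mul1r sqrf_eq0 => /(_ isT)/eqP.
rewrite negbK => /flattenP[_ /mapP[Cx CxP ->] /mapP[j /tnthP[l jx] /val_inj ij]].
move: lat0; rewrite psumr_eq0 => [/allP/(_ _ CxP)/= /eqP V0|? _]; last first.
  by rewrite sumr_ge0// => ? _; exact: sqr_ge0.
have [rkV _ _ _] := hL (allP (constraints_in Phi) _ CxP).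
have Vx : sl_basis (L Cx.1) *m sel Cx.2 w = 0.
  apply/colP => r; apply/eqP; rewrite [X in _ == X]mxE -sqrf_eq0.
  by rewrite (psumr_eq0P _ V0)// => ? _; exact: sqr_ge0.
have /row_free_inj Vinj : row_free (sl_basis (L Cx.1))^T.
  by rewrite /row_free mxrank_tr rkV.
have /(congr1 trmx) : (sel Cx.2 w)^T = 0.
  by apply: Vinj; rewrite -trmx_mul Vx trmx0 mul0mx.
by rewrite trmxK trmx0 => /colP/(_ l); rewrite !mxE -jx ij.
Qed.

Lemma rval_red_radius Phi :
  rval K (red_radius e0 Phi) = (size (constraints Phi))%:R * rval K e0.
Proof.
rewrite /red_radius; elim: (constraints Phi) => [|Cx s /= ->].
  by rewrite /= mul0r.
by rewrite mulrS mulrDl mul1r.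
Qed.

Definition red_dist Phi (z : 'cV[int]_(nvars Phi)) : R :=
  \sum_(Cx <- constraints Phi) sl_dist p (L Cx.1) (sel Cx.2 z) `^ p +
  \sum_i `|(free_var i)%:R * (z i 0)%:~R| `^ p.

Lemma lpnorm_red Phi (z : 'cV[int]_(nvars Phi)) :
  lpnorm p (rows_basis K (nvars Phi) (red_rows L K Phi) *m intcol R z -
            rows_target K (red_rows L K Phi)) = red_dist z `^ p^-1.
Proof.
rewrite lpnorm_rows (sum_red_rows (fun x y => `|x - y| `^ p)).
congr ((_ + _) `^ _); last by apply: eq_bigr => i _; rewrite subr0 mxE.
apply: eq_bigr => Cx _; rewrite /sl_dist lpnorm_powR; apply: eq_bigr => i _.
rewrite !mxE; congr (`| _ - _ | `^ _); apply: eq_bigr => l _.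
by rewrite !mxE.
Qed.

Definition red_cost Phi (a : {ffun 'I_(nvars Phi) -> bool}) : R :=
  (size (constraints Phi))%:R * E - (nsat a)%:R * (E - 1).

Lemma red_costE Phi (a : {ffun 'I_(nvars Phi) -> bool}) :
  red_cost a =
  \sum_(Cx <- constraints Phi) (if Cx.1 (map_tuple a Cx.2) then 1 else E).
Proof.
rewrite /red_cost /nsat; elim: (constraints Phi) => [|Cx s IH].
  by rewrite big_nil !mul0r subr0.
rewrite big_cons -IH /=; case: (Cx.1 _) => /=; rewrite ?add0n ?add1n !mulrS; ring.
Qed.

Lemma E_gt1 : 1 < E.
Proof.
have -> : 1 = 1 `^ p :> R by rewrite powR1.
rewrite /E gt0_ltr_powR// ?nnegrE ?ler01//.
- by rewrite addr_ge0// ltW.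
- by rewrite ltrDl.
Qed.

Lemma dist_powR_bitcol C (b : k.-tuple bool) : C \in CC ->
  sl_dist p (L C) (bitcol b) `^ p = if C b then 1 else E.
Proof.
move=> /hL[_ h1 h2 _]; case: ifPn => [/h1 ->|/h2 -> //]; by rewrite powR1.
Qed.

(** Rounding keeps 1 and sends every other value to 0. A constraint that sees only 0/1 values keeps
    its cost; any other already pays at least E, the most that an assignment can pay for it. The
    free rows only add. *)
Lemma red_cost_le Phi (z : 'cV[int]_(nvars Phi)) :
  red_cost [ffun j => z j 0 == 1] <= red_dist z.
Proof.
rewrite red_costE /red_dist -[leLHS]addr0 lerD//; last first.
  by apply: sumr_ge0 => i _; exact: powR_ge0.
rewrite big_seq [leRHS]big_seq; apply: ler_sum => Cx CxP.
have CxC := allP (constraints_in Phi) _ CxP.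
have [[b zb]|zN] := pselect (exists b : k.-tuple bool, sel Cx.2 z = bitcol b).
  rewrite zb dist_powR_bitcol//.
  suff -> : map_tuple [ffun j => z j 0 == 1] Cx.2 = b by [].
  apply: eq_from_tnth => l; rewrite tnth_map ffunE.
  by move/colP/(_ l): zb; rewrite !mxE => ->; case: (tnth b l).
apply: (@le_trans _ _ E); first by case: ifP => // _; exact: ltW E_gt1.
have [_ _ _ h] := hL CxC.
rewrite /E ge0_ler_powR ?nnegrE ?(ltW p_gt0)//.
- by rewrite addr_ge0// ltW.
- exact: powR_ge0.
- by apply: h => b zb; apply: zN; exists b.
Qed.

(** Free coordinates are set to 0, so that the free rows contribute nothing and the cost is attained
    exactly. *)
Definition red_point Phi (a : {ffun 'I_(nvars Phi) -> bool}) :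
    'cV[int]_(nvars Phi) :=
  \col_i (~~ free_var i && a i : nat)%:Z.

Lemma red_dist_point Phi (a : {ffun 'I_(nvars Phi) -> bool}) :
  red_dist (red_point a) = red_cost a.
Proof.
rewrite red_costE /red_dist [X in _ + X]big1 ?addr0 => [|i _]; last first.
  rewrite mxE; case: (free_var i) => /=; rewrite ?mulr0 ?mul0r normr0 powR0//.
    by rewrite gt_eqF.
  by rewrite gt_eqF.
apply: eq_big_seq => Cx CxP.
have CxC := allP (constraints_in Phi) _ CxP.
rewrite -(dist_powR_bitcol (map_tuple a Cx.2) CxC).
suff -> : sel Cx.2 (red_point a) = bitcol (map_tuple a Cx.2) by [].
by apply/colP => l; rewrite !mxE tnth_map (free_varN l CxP).
Qed.

Hypothesis he0 : 0 < rval K e0.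

Lemma red_radius_gt0 Phi : 0 < rval K (red_radius e0 Phi) `^ p^-1.
Proof.
by rewrite powR_gt0// rval_red_radius mulr_gt0// ltr0n constraints_neq0.
Qed.

Definition red_instance Phi : cvp_instance R :=
  @CVPInstance R _ _ _ (rows_target K (red_rows L K Phi)) _
    (rank_red_basis Phi) (red_radius_gt0 Phi).

Lemma red_repr Phi : cvp_repr p K (enc_red L K e0 Phi) (red_instance Phi).
Proof.
pose rows := red_rows L K Phi.
exists (fun i j => nth RZero (nth ([::], RZero) rows i).1 j).
exists (fun i => (nth ([::], RZero) rows i).2), (red_radius e0 Phi).
split => //= [|i j|i]; rewrite ?mxE//.
rewrite /enc_red /=; do 2![congr (Node _ _)]; congr (Node (enc_seq _) _); last first.
  by rewrite (map_nth_ord ([::], RZero) (fun r => enc_rexpr r.2)).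
rewrite (map_nth_ord ([::], RZero) (fun r => enc_seq
  [seq enc_rexpr (nth RZero r.1 (nat_of_ord j)) | j <- enum 'I_(nvars Phi)]))//.
rewrite /rows; elim: (red_rows L K Phi) (size_red_rows Phi) => //= r rs IH.
by move=> /andP[/eqP sr /IH ->]; rewrite map_nth_ord.
Qed.

Lemma cvp_dist_le Phi (a : {ffun 'I_(nvars Phi) -> bool}) :
  cvp_dist p (red_instance Phi) <= red_cost a `^ p^-1.
Proof.
apply: ge_inf; first by exists 0 => _ [z ->]; exact: powR_ge0.
by exists (red_point a); rewrite lpnorm_red red_dist_point.
Qed.

(** Each integer point is at least as far as the cost of its rounding, so a bound over all
    assignments passes to the infimum. *)
Lemma cvp_dist_ge Phi (y : R) :
  (forall a : {ffun 'I_(nvars Phi) -> bool}, 0 <= y <= red_cost a) ->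
  y `^ p^-1 <= cvp_dist p (red_instance Phi).
Proof.
move=> hy; apply: lb_le_inf.
  (* The zero vector witnesses that the set of distances is nonempty. *)
  by exists (lpnorm p (cvp_basis (red_instance Phi) *m intcol R 0 -
                       cvp_target (red_instance Phi))), 0.
move=> _ [z ->]; rewrite lpnorm_red.
have /andP[y0 yc] := hy [ffun j => z j 0 == 1].
have yd := le_trans yc (red_cost_le z).
by rewrite ge0_ler_powR ?nnegrE ?invr_ge0 ?(ltW p_gt0)// (le_trans y0).
Qed.

Lemma red_yes Phi (c : R) : 0 < c -> rval K e0 = c + (1 - c) * E ->
  c <= csp_val R Phi ->
  cvp_dist p (red_instance Phi) <= cvp_radius (red_instance Phi).
Proof.
(* The maximum starts from 0: either c <= 0, which is excluded, or some assignment reaches the ratio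
   c. *)
move=> c0 e0E /bigmax_geP[|[a _ ca]]; first by rewrite leNgt c0.
apply: le_trans (cvp_dist_le a) _.
have m0 : 0 < (size (constraints Phi))%:R :> R by rewrite ltr0n constraints_neq0.
have sat_le : (nsat a)%:R <= (size (constraints Phi))%:R :> R.
  by rewrite ler_nat count_size.
have E1 := E_gt1; rewrite ler_pdivlMr// in ca.
rewrite /= ge0_ler_powR ?nnegrE ?invr_ge0 ?(ltW p_gt0)//.
- by rewrite /red_cost; nra.
- by rewrite rval_red_radius mulr_ge0// ltW.
- by rewrite /red_cost rval_red_radius e0E; nra.
Qed.

Lemma red_no Phi (s : R) : 0 < s -> s <= 1 -> csp_val R Phi < s ->
  ((s + (1 - s) * E) / rval K e0) `^ p^-1 * cvp_radius (red_instance Phi) <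
  cvp_dist p (red_instance Phi).
Proof.
move=> s0 s1 vs; have E1 := E_gt1.
set m := (size (constraints Phi))%:R : R.
have m0 : 0 < m by rewrite ltr0n constraints_neq0.
have rs0 : 0 < s + (1 - s) * E by nra.
(* The value of [e0] cancels, so that gamma times the radius is the p-th root of
   [m * (s + (1 - s) * E)]. *)
rewrite /= rval_red_radius -powRM ?divr_ge0 ?mulr_ge0 ?(ltW rs0) ?(ltW he0) ?ler0n//.
rewrite mulrCA divfK ?gt_eqF// -/m.
set v := csp_val R Phi in vs.
(* An infimum does not preserve strict bounds. The strict step is therefore taken here, up to a
   bound in terms of the value [v] that holds weakly for all assignments. *)
have lt_vs : m * (s + (1 - s) * E) < m * (E - v * (E - 1)).
  by rewrite ltr_pM2l//; nra.
apply: (@lt_le_trans _ _ ((m * (E - v * (E - 1))) `^ p^-1)).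
  have ms0 : 0 <= m * (s + (1 - s) * E) by rewrite mulr_ge0 ?ltW.
  by rewrite gt0_ltr_powR ?nnegrE ?invr_gt0// (le_trans ms0)// ltW.
apply: cvp_dist_ge => a; apply/andP; split.
  by rewrite (le_trans _ (ltW lt_vs))// mulr_ge0 ?ltW.
have : (nsat a)%:R / m <= v by apply: (le_bigmax _ (fun a => (nsat a)%:R / m)).
by rewrite ler_pdivrMr// /red_cost -/m => av; nra.
Qed.

End Reduction.

(** * From polynomial-time functions to the theorem *)

Lemma karp_reduction_polytime (A B : promise_problem)
    (rel : instance A -> instance B -> Prop) (F : tree -> tree)
    (f : instance A -> instance B) :
  polytime F -> (forall w x, repr w x -> repr (F w) (f x)) ->
  (forall x, rel x (f x)) -> (forall x, yes x -> yes (f x)) ->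
  (forall x, no x -> no (f x)) -> karp_reduction rel.
Proof.
(* Execution starts at function 0, which is taken by [e], so the code of [Ps] begins at offset 1. *)
move=> /(_ 1%N)[Ps [e [T [[a [b Tb]] H]]]] hrepr hrel hyes hno.
exists (e :: Ps), a, b => w x wx.
have [t ev tT] := H [:: e] [::] erefl w; rewrite cats0 in ev.
exists (F w), t, (f x); split; split=> //; last by move/hno.
- exact: leq_trans tT (Tb w).
- exact: hrepr.
- by move/hyes.
Qed.

Theorem theorem4p7 (R : realType) (k : nat) (CC : {set kconstraint k})
    (p eps : R) (L : kconstraint k -> shifted_lattice R k)
    (hk : (0 < k)%N) (hp : 1 <= p) (heps : 0 < eps)
    (hL : forall C : kconstraint k, C \in CC ->
            isolating_lattice p C eps (L C) /\ computable_lattice (L C))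
    (s c : R) (hs : 0 < s) (hsc : s <= c) (hc : c <= 1) :
  exists gamma : R,
    [/\ 0 < gamma,
        gamma `^ p = (1 - s * (1 - 1 / (1 + eps) `^ p)) /
                     (1 - c * (1 - 1 / (1 + eps) `^ p)) &
        exists K : seq R,
          (forall x : R, x \in K -> reduction_constant CC L p eps s c x) /\
          @karp_reduction (gap_csp CC s c) (gap_cvp p gamma K)
            (fun (Phi : csp_instance CC) (I : cvp_instance R) =>
               cvp_rank I = nvars Phi)].

Proof.
have p0 : 0 < p by apply: lt_le_trans hp.
pose E := (1 + eps) `^ p.
have E1 : 1 < E by apply: E_gt1.
have rho_gt0 x : 0 < x -> x <= 1 -> 0 < x + (1 - x) * E by move=> *; nra.
have c0 : 0 < c by apply: lt_le_trans hsc.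
have rc0 := rho_gt0 _ c0 hc; have rs0 := rho_gt0 _ hs (le_trans hsc hc).
pose ents (C : kconstraint k) : seq R :=
  [seq sl_basis (L C) i j | i <- enum 'I_(sl_dim (L C)), j <- enum 'I_k] ++
  [seq sl_target (L C) i 0 | i <- enum 'I_(sl_dim (L C))].
(* [c] and [E] come first, at the positions 0 and 1 by which [e0] refers to them; [e0] then denotes
   [c + (1 - c) * E]. *)
pose K := [:: c, E & flatten [seq ents C | C <- enum CC]].
pose e0 := RAdd (RConst 0) (RMul (RAdd ROne (ROpp (RConst 0))) (RConst 1)).
have hL1 C : C \in CC -> isolating_lattice p C eps (L C) by case/hL.
have hK C x : C \in CC -> is_entry (L C) x -> x \in K.
  move=> CCC xC; rewrite !inE; apply/orP; right; apply/orP; right.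
  apply/flattenP; exists (ents C); first by apply: map_f; rewrite mem_enum.
  rewrite mem_cat; case: xC => [[i [j ->]]|[i ->]]; apply/orP; [left|right].
    by apply: allpairs_f; rewrite mem_enum.
  by apply: map_f; rewrite mem_enum.
exists (((s + (1 - s) * E) / (c + (1 - c) * E)) `^ p^-1); split.
- by rewrite powR_gt0// divr_gt0.
- rewrite -powRrM mulVf ?gt_eqF// powRr1 ?divr_ge0 ?ltW// -/E.
  have En0 : E != 0 by rewrite gt_eqF// (lt_trans ltr01).
  (* Extending the fraction by E gives the stated form of gamma^p. *)
  have rcE : 1 - c * (1 - 1 / E) = (c + (1 - c) * E) / E by field.
  have rsE : 1 - s * (1 - 1 / E) = (s + (1 - s) * E) / E by field.
  by rewrite rcE rsE invf_div mulrA divfK.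
exists K; split=> [x|].
  rewrite !inE => /or3P[/eqP ->|/eqP ->|/flattenP[_ /mapP[C CCC ->]]].
  - by left; rewrite !inE eqxx !orbT.
  - by left; rewrite !inE eqxx !orbT.
  rewrite mem_enum in CCC; rewrite mem_cat.
  case/orP=> [/allpairsP[[i j] [_ _ ->]]|/mapP[i _ ->]].
    by right; exists C => //; left; exists i, j.
  by right; exists C => //; right; exists i.
(* [rval K e0] reduces to [c + (1 - c) * E], which makes this [rc0]. *)
have he0 : 0 < rval K e0 by [].
apply: (@karp_reduction_polytime (gap_csp CC s c) (gap_cvp p _ K) _
          (tred CC L K e0) (red_instance hL1 hK he0)).
- exact: polytime_tred.
- by move=> w Phi ->; rewrite tredE; apply: red_repr.
- by [].
- by move=> Phi; apply: red_yes.
- by move=> Phi; exact: (red_no hp heps hL1 hK he0 hs (le_trans hsc hc)).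
Qed.
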